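(* For an arbitrary permutation $\alpha$ of $\{1,2,\dots,m\}$, $$F_\varepsilon(\alpha)=\sum_{U\subset\{1,2,\dots,m\}}N^{\,c(\alpha)-c(\alpha|_U)+f(\alpha|_U)-1}\,\varepsilon^{\,m-|U|},$$ the sum being over all $2^m$ subsets $U$.
   Context: For a positive integer $N$, let $E_{ij}$ be the matrix units of $\mathfrak{gl}(N)$. For $\alpha\in\mathbb S_m$ set $w_{\mathfrak{gl}(N)}(\alpha)=\sum_{i_1,\dots,i_m=1}^N E_{i_1i_{\alpha(1)}}\cdots E_{i_mi_{\alpha(m)}}\in U\mathfrak{gl}(N)$, and $C_k^{(N)}=w_{\mathfrak{gl}(N)}((1,2,\dots,k))$. The universal $\mathfrak{gl}$-weight system $w_{\mathfrak{gl}}(\alpha)$ is the (unique; existence by a theorem of Z. Yang) polynomial in $\mathbb C[N,C_1,C_2,\dots]$ such that for every positive integer $N$, substituting this integer for $N$ and $C_k^{(N)}$ for $C_k$ yields $w_{\mathfrak{gl}(N)}(\alpha)$; $w_{\mathfrak{gl}}(\text{empty})=1$, $w_{\mathfrak{gl}}((1,\dots,k))=C_k$. Define $F_\varepsilon(\alpha)\in\mathbb C[N,\varepsilon]$ as the result of substituting $C_k:=\frac1N\big((N+\varepsilon)^k-(1-N^2)\varepsilon^k\big)$ for all $k\ge1$ into $w_{\mathfrak{gl}}(\alpha)$ (so $C_1=1+N\varepsilon$, $C_2=N+2\varepsilon+N\varepsilon^2$, …). $c(\alpha)$ is the number of cycles of $\alpha$. The number of faces $f(\beta)$ of $\beta\in\mathbb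 S_k$ is the number of cycles of $\beta^{-1}\sigma_k^{-1}$, $\sigma_k=(1,2,\dots,k)$; for the empty permutation $f=1$ and $c=0$. For $U\subset\{1,\dots,m\}$, the subpermutation $\alpha|_U$ is the permutation of $U$ sending $u\in U$ to the first element of the sequence $\alpha(u),\alpha^2(u),\dots$ lying in $U$, regarded as a permutation of $\{1,\dots,|U|\}$ via the order-preserving bijection $U\to\{1,\dots,|U|\}$.
   Formalization: The number of faces f(β) is taken as the number of cycles of β^{-1}σ_k instead of β^{-1}σ_k^{-1}; with the latter the formula fails for α=(1,2,3), where the ε^0 term of F_ε is N^2 but the right side gives 1. For involutions the two counts agree. *)

(* Defs.v *)
From HB Require Import structures.
From mathcomp Require Import all_boot all_order all_fingroup all_algebra.
From mathcomp Require Import finmap generic_quotient ring_quotient.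
From mathcomp Require Import boolp reals ring zify.
From mathcomp.real_closed Require Import complex.
From mathcomp.multinomials Require Import monalg.

Set Implicit Arguments.
Unset Strict Implicit.
Unset Printing Implicit Defensive.

Import GRing.Theory.
Local Open Scope ring_scope.
Local Open Scope quotient_scope.

(* The library only quotients commutative rings; here is the quotient of *)
(* an arbitrary ring by a proper two-sided ideal.                        *)

Inductive ideal_span (A : nzRingType) (G : A -> Prop) : A -> Prop :=
| ideal_span_gen x : G x -> ideal_span G x
| ideal_span_zero : ideal_span G 0
| ideal_span_sub x y : ideal_span G x -> ideal_span G y -> ideal_span G (x - y)
| ideal_span_mull a x : ideal_span G x -> ideal_span G (a * x)
| ideal_span_mulr a x : ideal_span G x -> ideal_span G (x * a).

Record two_sided_ideal (A : nzRingType) := TwoSidedIdeal {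
  tsi_pred :> pred A;
  tsi_zmod : zmod_closed tsi_pred;
  tsi_mull : forall a x, x \in tsi_pred -> a * x \in tsi_pred;
  tsi_mulr : forall a x, x \in tsi_pred -> x * a \in tsi_pred;
  tsi_proper : 1 \notin tsi_pred }.

HB.instance Definition _ (A : nzRingType) (I : two_sided_ideal A) :=
  GRing.isZmodClosed.Build A (tsi_pred I) (tsi_zmod I).

Section TwoSidedQuotient.
Context (A : nzRingType) (I : two_sided_ideal A).

Definition tsi_zmodClosed : zmodClosed A :=
  GRing.ZmodClosed.clone A (tsi_pred I) _.

Definition ts_quot := Quotient.quot tsi_zmodClosed.

HB.instance Definition _ := GRing.Zmodule.on ts_quot.
HB.instance Definition _ : EqQuotient A (Quotient.equiv tsi_zmodClosed) ts_quot :=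
  EqQuotient.on ts_quot.

Definition ts_one : ts_quot := lift_cst ts_quot 1.
Definition ts_mul := lift_op2 ts_quot *%R.

Canonical ts_pi_one_morph := PiConst ts_one.

Fact ts_pi_mul : {morph \pi_ts_quot : x y / x * y >-> ts_mul x y}.
Proof.
move=> x y; unlock ts_mul; apply/eqP; rewrite piE Quotient.equivE.
rewrite -[_ * _](addrNK (x * repr (\pi_ts_quot y))) -mulrBr -addrA -mulrBl.
rewrite rpredD //.
  by apply: tsi_mull; rewrite Quotient.idealrBE reprK.
by apply: tsi_mulr; rewrite Quotient.idealrBE reprK.
Qed.
Canonical ts_pi_mul_morph := PiMorph2 ts_pi_mul.

Fact ts_mulA : associative ts_mul.
Proof. by move=> x y z; rewrite -[x]reprK -[y]reprK -[z]reprK !piE mulrA. Qed.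

Fact ts_mul1 : left_id ts_one ts_mul.
Proof. by move=> x; rewrite -[x]reprK !piE mul1r. Qed.

Fact ts_mulr1 : right_id ts_one ts_mul.
Proof. by move=> x; rewrite -[x]reprK !piE mulr1. Qed.

Fact ts_mulDl : left_distributive ts_mul +%R.
Proof.
move=> x y z; rewrite -[x]reprK -[y]reprK -[z]reprK.
by rewrite -(raddfD \pi_ts_quot) -!ts_pi_mul mulrDl (raddfD \pi_ts_quot).
Qed.

Fact ts_mulDr : right_distributive ts_mul +%R.
Proof.
move=> x y z; rewrite -[x]reprK -[y]reprK -[z]reprK.
by rewrite -(raddfD \pi_ts_quot) -!ts_pi_mul mulrDr (raddfD \pi_ts_quot).
Qed.

Fact ts_one_neq0 : ts_one != 0.
Proof. by rewrite piE Quotient.equivE subr0 tsi_proper. Qed.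

HB.instance Definition _ := GRing.Zmodule_isNzRing.Build ts_quot
  ts_mulA ts_mul1 ts_mulr1 ts_mulDl ts_mulDr ts_one_neq0.

Definition ts_proj (x : A) : ts_quot := \pi_ts_quot x.

Fact ts_proj_is_zmod_morphism : zmod_morphism ts_proj.
Proof. by move=> x y; rewrite /ts_proj (raddfB \pi_ts_quot). Qed.
HB.instance Definition _ :=
  GRing.isZmodMorphism.Build A ts_quot ts_proj ts_proj_is_zmod_morphism.

Fact ts_proj_is_monoid_morphism : monoid_morphism ts_proj.
Proof.
split=> [|x y]; last exact: ts_pi_mul.
by rewrite /ts_proj -[RHS]/ts_one; unlock ts_one.
Qed.
HB.instance Definition _ :=
  GRing.isMonoidMorphism.Build A ts_quot ts_proj ts_proj_is_monoid_morphism.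

Fact ts_projE x y : (ts_proj x == ts_proj y) = (x - y \in tsi_pred I).
Proof. by rewrite -Quotient.idealrBE. Qed.

End TwoSidedQuotient.

(* A ring morphism to a nonzero ring that kills G witnesses properness.  *)
Section SpannedIdeal.
Context (A B : nzRingType) (G : A -> Prop) (f : {rmorphism A -> B}).
Context (fG : forall x, G x -> f x = 0).

Definition span_pred : pred A := fun x => `[< ideal_span G x >].

Fact span_zmod : zmod_closed span_pred.
Proof.
split=> [|x y]; first by apply/asboolP; exact: ideal_span_zero.
by move=> /asboolP xI /asboolP yI; apply/asboolP; exact: ideal_span_sub.
Qed.

Fact span_mull a x : x \in span_pred -> a * x \in span_pred.
Proof. by move=> /asboolP xI; apply/asboolP; exact: ideal_span_mull. Qed.

Fact span_mulr a x : x \in span_pred -> x * a \in span_pred.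
Proof. by move=> /asboolP xI; apply/asboolP; exact: ideal_span_mulr. Qed.

Fact span_proper : 1 \notin span_pred.
Proof.
have kill x : ideal_span G x -> f x = 0.
  elim=> {x} [x /fG//||x y _ IHx _ IHy|a x _ IHx|a x _ IHx].
  - exact: rmorph0.
  - by rewrite rmorphB IHx IHy subrr.
  - by rewrite rmorphM IHx mulr0.
  - by rewrite rmorphM IHx mul0r.
by apply/negP => /asboolP /kill /eqP; rewrite rmorph1 oner_eq0.
Qed.

Definition spanned_ideal : two_sided_ideal A :=
  TwoSidedIdeal span_zmod span_mull span_mulr span_proper.

End SpannedIdeal.

(* U gl(N) is the quotient of the free associative algebra on the        *)
(* letters E_ij (i, j < N) by the two-sided ideal spanned by             *)
(*   E_ij E_kl - E_kl E_ij - (delta_jk E_il - delta_li E_kj).            *)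

Section Relators.
Context (N : nat).

Definition gl_relator (A : nzRingType) (e : 'I_N -> 'I_N -> A)
    (i j k l : 'I_N) : A :=
  e i j * e k l - e k l * e i j - (e i l *+ (j == k) - e k j *+ (l == i)).

Fact gl_relator_morph (A B : nzRingType) (f : {rmorphism A -> B}) e i j k l :
  f (gl_relator e i j k l) = gl_relator (fun p q => f (e p q)) i j k l.
Proof. by rewrite /gl_relator !rmorphB !rmorphM !rmorphMn. Qed.

Fact gl_relator0 (A : nzRingType) (e : 'I_N -> 'I_N -> A) i j k l :
  (forall p q, e p q = 0) -> gl_relator e i j k l = 0.
Proof. by move=> e0; rewrite /gl_relator !e0 !mul0rn mul0r !subr0. Qed.

End Relators.

Section EnvelopingAlgebra.
Context (K : fieldType) (N : nat).

Definition gl_free : Type := {malg K[{fmonom ('I_N * 'I_N)%type}]}.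
HB.instance Definition _ := GRing.NzRing.on gl_free.

Definition gl_letter (i j : 'I_N) : gl_free := << fmu (i, j) >>.

Definition gl_relations (x : gl_free) : Prop :=
  exists i j k l, x = gl_relator gl_letter i j k l.

Definition gl_augmentation : {rmorphism gl_free -> K} :=
  GRing.RMorphism.clone _ _ (@mcoeff _ K mone) _.

Fact gl_augmentation_relations x : gl_relations x -> gl_augmentation x = 0.
Proof.
move=> [i [j [k [l ->]]]]; rewrite gl_relator_morph gl_relator0 // => p q.
by rewrite /= /gl_letter mcoeffU1 fm1_eq1.
Qed.

Definition Ugl : nzRingType :=
  ts_quot (spanned_ideal gl_augmentation_relations).

Definition Ugl_proj : {rmorphism gl_free -> Ugl} :=
  GRing.RMorphism.clone _ _ (@ts_proj gl_free _) _.

Definition Ugl_scalar (a : K) : Ugl := Ugl_proj a%:MP.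

Definition Ugl_E (i j : 'I_N) : Ugl := Ugl_proj (gl_letter i j).

Fact Ugl_E_comm i j k l :
  Ugl_E i j * Ugl_E k l - Ugl_E k l * Ugl_E i j =
  Ugl_E i l *+ (j == k) - Ugl_E k j *+ (l == i).
Proof.
apply/eqP; rewrite -subr_eq0 -[X in X == _](gl_relator_morph Ugl_proj).
rewrite -(rmorph0 Ugl_proj) [_ == _]ts_projE subr0.
by apply/asboolP/ideal_span_gen; exists i, j, k, l.
Qed.

End EnvelopingAlgebra.

Definition std_cycle (k : nat) : 'S_k := perm (@ordS_inj k).

Definition w_glN (K : fieldType) (N m : nat) (alpha : 'S_m) : Ugl K N :=
  \sum_(i : {ffun 'I_m -> 'I_N}) \prod_(k < m) Ugl_E K (i k) (i (alpha k)).

Definition casimir (K : fieldType) (N k : nat) : Ugl K N :=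
  w_glN K N (std_cycle k).

(* K[N, C_1, C_2, ...] is represented as K[N][C_1, C_2, ...]; the        *)
(* variable of index k in [{cmonom nat}] stands for C_{k+1}.             *)

Definition glpoly (K : fieldType) := {malg {poly K}[{cmonom nat}]}.

Definition glpoly_C (K : fieldType) (k : nat) : glpoly K := << ucm k.-1 >>.

(* Substitution of [c k] for C_k, with [f] applied to the coefficients.  *)
(* In a noncommutative S the value of a monomial depends on the order of *)
(* the factors unless the [c k] commute; the Casimir elements are        *)
(* central.                                                              *)
Definition glpoly_subst (K : fieldType) (S : nzRingType) (f : {poly K} -> S)
    (c : nat -> S) (P : glpoly K) : S :=
  mmap f (fun mon : {cmonom nat} => \prod_(k <- finsupp mon) c k.+1 ^+ mon k) P.

Definition is_w_gl (K : fieldType) (m : nat) (alpha : 'S_m) (P : glpoly K) :=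
  forall N : nat, (0 < N)%N ->
    glpoly_subst (fun p : {poly K} => Ugl_scalar N p.[N%:R])
      (fun k => casimir K N k) P
    = w_glN K N alpha.

(* K[N, eps] is represented as K[eps][N]: the outer 'X is N and the      *)
(* constant 'X%:P is eps.                                                *)

Definition varN (K : fieldType) : {poly {poly K}} := 'X.
Definition varEps (K : fieldType) : {poly {poly K}} := 'X%:P.

Definition eps_numer (K : fieldType) (k : nat) : {poly {poly K}} :=
  (varN K + varEps K) ^+ k - (1 - varN K ^+ 2) * varEps K ^+ k.

(* The division by N is exact, see [eps_casimirE].                       *)
Definition eps_casimir (K : fieldType) (k : nat) : {poly {poly K}} :=
  (eps_numer K k %/ varN K)%R.

Fact eps_casimirE (K : fieldType) k :
  varN K * eps_casimir K k = eps_numer K k.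
Proof.
rewrite mulrC /eps_casimir /varN Pdiv.WeakIdomain.divpK.
  by rewrite lead_coefX expr1n scale1r.
rewrite -['X]subr0 -polyC0 dvdp_XsubCl /root /eps_numer /varN /varEps.
by rewrite !hornerE expr0n /= subr0 mul1r subrr.
Qed.

Fact eps_casimir1 (K : fieldType) :
  eps_casimir K 1 = 1 + varN K * varEps K.
Proof.
apply: (mulfI (negbT (polyX_eq0 _) : varN K != 0)).
by rewrite eps_casimirE /eps_numer; ring.
Qed.

Fact eps_casimir2 (K : fieldType) :
  eps_casimir K 2 = varN K + 2%:R * varEps K + varN K * varEps K ^+ 2.
Proof.
apply: (mulfI (negbT (polyX_eq0 _) : varN K != 0)).
by rewrite eps_casimirE /eps_numer; ring.
Qed.

Definition F_eps (K : fieldType) (P : glpoly K) : {poly {poly K}} :=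
  glpoly_subst (map_poly polyC) (eps_casimir K) P.

Definition ncycles (T : finType) (s : {perm T}) : nat := #|porbits s|.

(* The faces are the cycles of beta^-1 sigma with sigma = (1,...,k); the *)
(* order of composition does not matter, as the two products are         *)
(* conjugate. With E_{i_k i_{beta(k)}} in w_glN it has to be sigma and   *)
(* not sigma^-1: F_eps = C_k = N^(k-1) + O(eps) at beta = sigma forces   *)
(* f(sigma) = k (see [nfaces_std_cycle]), whereas sigma^-1 sigma^-1 has  *)
(* only one cycle for k = 3. For involutions both products have the same *)
(* number of cycles.                                                     *)
Definition nfaces (k : nat) (beta : 'S_k) : nat :=
  if k == 0%N then 1%N else ncycles (beta^-1 * std_cycle k)%g.

Section SubPermutation.
Context (m : nat) (alpha : 'S_m) (U : {set 'I_m}).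

(* The first element of alpha x, alpha (alpha x), ... lying in U; for x  *)
(* in U it is found among the first m ones.                              *)
Definition first_return (x : 'I_m) : 'I_m :=
  iter (find [in U] (traject alpha (alpha x) m)) alpha (alpha x).

Lemma first_returnP x : x \in U ->
  exists n, [/\ first_return x = iter n.+1 alpha x, first_return x \in U &
             forall k, (k < n)%N -> iter k.+1 alpha x \notin U].
Proof.
move=> xU; pose t := traject alpha (alpha x) m.
have hasU : has [in U] t.
  have conn : fconnect alpha (alpha x) x.
    by rewrite fconnect_sym ?fconnect1 //; exact: perm_inj.
  apply/hasP; exists x => //; apply/trajectP; exists (findex alpha (alpha x) x).
    rewrite -[X in (_ < X)%N]card_ord; apply: leq_trans (max_card _).
    exact: findex_max conn.
  by rewrite iter_findex.
have ltn : (find [in U] t < m)%N by move: hasU; rewrite has_find size_traject.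
have nthE k : (k < m)%N -> nth (alpha x) t k = iter k alpha (alpha x).
  by move=> km; rewrite /t nth_traject.
exists (find [in U] t); split; first by rewrite iterSr.
  by have := nth_find (alpha x) hasU; rewrite nthE.
move=> k kn; have := before_find (alpha x) kn; rewrite nthE -?iterSr => [/= ->//|].
exact: ltn_trans kn ltn.
Qed.

Lemma first_return_mem x : x \in U -> first_return x \in U.
Proof. by case/first_returnP=> n []. Qed.

Lemma iter_perm_inj n : injective (iter n alpha).
Proof. by elim: n => [//|n IH] x y /= /perm_inj /IH. Qed.

Lemma first_return_inj : {in U &, injective first_return}.
Proof.
have aux x y n k : x \in U -> y \in U -> (n <= k)%N ->
    iter n.+1 alpha x = iter k.+1 alpha y ->
    (forall j, (j < k)%N -> iter j.+1 alpha y \notin U) -> x = y.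
  move=> xU yU; rewrite leq_eqVlt => /predU1P[->|lt_nk e min].
    by move=> /iter_perm_inj.
  have kE : (k.+1 = n.+1 + (k - n).-1.+1)%N by lia.
  have lt_k : ((k - n).-1 < k)%N by lia.
  move: e; rewrite kE iterD => /iter_perm_inj xE.
  by have := min _ lt_k; rewrite -xE xU.
move=> x y xU yU.
have [n [-> _ minx]] := first_returnP xU; have [k [-> _ miny]] := first_returnP yU.
have [le_nk e|/ltnW le_kn /esym e] := leqP n k; first exact: aux le_nk e miny.
by apply/esym; exact: aux le_kn e minx.
Qed.

Definition subperm_fun (u : 'I_#|U|) : 'I_#|U| :=
  enum_rank_in (enum_valP u) (first_return (enum_val u)).

Lemma subperm_inj : injective subperm_fun.
Proof.
move=> u v /(congr1 (@enum_val _ _)).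
rewrite !enum_rankK_in ?first_return_mem ?enum_valP //.
by move=> /first_return_inj /enum_val_inj -> //; exact: enum_valP.
Qed.

(* [enum_val] is increasing on ordinals, so it is the order-preserving   *)
(* bijection from the #|U| first ordinals onto U.                        *)
Definition subperm : 'S_#|U| := perm subperm_inj.

Lemma subperm_orbit n (u v : 'I_#|U|) :
  iter n alpha (enum_val u) = enum_val v -> v \in porbit subperm u.
Proof.
elim/ltn_ind: n u => -[|n] IH u; first by move=> /enum_val_inj ->; exact: porbit_id.
have [p [fE _ min]] := first_returnP (enum_valP u).
have [lt_np|le_pn] := ltnP n p.
  by move=> e; have := min _ lt_np; rewrite e enum_valP.
have -> : (n.+1 = n - p + p.+1)%N by lia.
rewrite iterD -fE => e.
have sE : enum_val (subperm u) = first_return (enum_val u).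
  by rewrite permE enum_rankK_in ?first_return_mem ?enum_valP.
have -> : porbit subperm u = porbit subperm (subperm u).
  apply/eqP; rewrite eq_porbit_mem porbit_sym.
  by apply/porbitP; exists 1%N; rewrite expg1.
by apply: (IH (n - p)%N); [lia | rewrite sE].
Qed.

End SubPermutation.

(* The exponent c(alpha) - c(alpha|_U) + f(alpha|_U) - 1 is a natural    *)
(* number, so truncated subtraction is harmless in it.                   *)
Lemma ncycles_subperm m (alpha : 'S_m) (U : {set 'I_m}) :
  (ncycles (subperm alpha U) <= ncycles alpha)%N.
Proof.
set b := subperm alpha U.
pose h (O : {set 'I_#|U|}) : {set 'I_m} :=
  if [pick u in O] is Some u then porbit alpha (enum_val u) else set0.
have hP O : O \in porbits b -> exists2 u, O = porbit b u & h O = porbit alpha (enum_val u).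
  move=> /imsetP[v _ ->]; rewrite /h; case: pickP => [u uv|/(_ v)].
    by exists u => //; apply/eqP; rewrite eq_sym eq_porbit_mem.
  by rewrite porbit_id.
have hinj : {in porbits b &, injective h}.
  move=> O P /hP[u -> ->] /hP[v -> ->] /eqP; rewrite eq_porbit_mem.
  rewrite porbit_sym => /porbitP[n e]; apply/eqP; rewrite eq_porbit_mem porbit_sym.
  by apply: (@subperm_orbit _ _ _ n); rewrite e permX.
rewrite /ncycles -(card_in_imset hinj); apply/subset_leq_card/subsetP => O.
by move=> /imsetP[P /hP[u _ ->] ->]; apply: imset_f.
Qed.

Lemma nfaces_gt0 k (beta : 'S_k) : (0 < nfaces beta)%N.
Proof.
rewrite /nfaces; case: k beta => [//|k] beta /=.
by apply/card_gt0P; exists (porbit (beta^-1 * std_cycle k.+1)%g ord0); apply: imset_f.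
Qed.

Lemma nfaces_std_cycle k : nfaces (std_cycle k.+1) = k.+1.
Proof.
rewrite /nfaces /= mulVg /ncycles /porbits card_imset ?card_ord // => x y.
move=> /eqP; rewrite eq_porbit_mem => /porbitP[n].
by rewrite expg1n perm1.
Qed.

Lemma is_w_gl_std_cycle (K : fieldType) k :
  is_w_gl (std_cycle k.+1) (glpoly_C K k.+1).
Proof.
move=> N _; rewrite /glpoly_subst /mmap msuppU1 big_seq_fset1 mcoeffUU.
rewrite mdomU big_seq_fset1 cmUU expr1 hornerE.
by rewrite /Ugl_scalar [X in Ugl_proj _ _ X]mpolyC1E rmorph1 mul1r.
Qed.

(* Main.v *)
Require Import Defs.
From HB Require Import structures.
From mathcomp Require Import all_boot all_order all_fingroup all_algebra.
From mathcomp Require Import finmap generic_quotient ring_quotient.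
From mathcomp Require Import boolp reals ring zify.
From mathcomp.real_closed Require Import complex.
From mathcomp.multinomials Require Import monalg.

Set Implicit Arguments.
Unset Strict Implicit.
Unset Printing Implicit Defensive.

Import GRing.Theory Num.Theory.
Local Open Scope ring_scope.

(* For every N > 0, the map E_ij |-> e_ij + eps delta_ij (the standard
   representation of gl(N), twisted by eps times the trace) sends C_k to the
   scalar ((N + eps)^k - (1 - N^2) eps^k) / N.  Hence it sends w_gl(N)(alpha) to
   the scalar matrix of F_eps(alpha) at N, and it is enough to compute the trace
   of this image.  Expanding the product, let U be the set of factors that
   contribute their matrix unit; the trace of the U-term is eps^(m - |U|) times
   the number of labellings i : {1..m} -> {1..N} that are constant on the cycles
   of h = alpha^-1 g_U, where g_U is the cyclic successor on U and the identity
   off U.  The first-return permutation of h on U is alpha|_U^-1 sigma_|U|, and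
   the cycles of h and of alpha avoiding U coincide, so
   c(h) = c(alpha) - c(alpha|_U) + f(alpha|_U).  Both sides of the theorem
   therefore agree at every positive integer N. *)

(** * Universal property of U gl(N) *)

Section QuotientLift.
Context (A B : nzRingType) (I : two_sided_ideal A) (f : {rmorphism A -> B}).
Hypothesis f_kill : forall x, x \in tsi_pred I -> f x = 0.

(* The unused proof argument is what lets the ring morphism instances below be
   inferred. *)
Definition ts_lift of (forall x, x \in tsi_pred I -> f x = 0) :=
  fun x : ts_quot I => f (repr x).

Local Notation lift := (ts_lift f_kill).

Lemma ts_proj_repr (x : ts_quot I) : ts_proj I (repr x) = x.
Proof. exact: reprK. Qed.

Lemma ts_lift_proj x : lift (ts_proj I x) = f x.
Proof.
apply/eqP; rewrite -subr_eq0 -rmorphB f_kill // -ts_projE.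
by rewrite ts_proj_repr.
Qed.

Fact ts_lift_is_zmod_morphism : zmod_morphism lift.
Proof.
move=> x y; rewrite -[x]ts_proj_repr -[y]ts_proj_repr.
by rewrite -rmorphB !ts_lift_proj rmorphB.
Qed.
HB.instance Definition _ :=
  GRing.isZmodMorphism.Build (ts_quot I) B lift ts_lift_is_zmod_morphism.

Fact ts_lift_is_monoid_morphism : monoid_morphism lift.
Proof.
split=> [|x y]; first by rewrite -(rmorph1 (@ts_proj A I)) ts_lift_proj rmorph1.
rewrite -[x]ts_proj_repr -[y]ts_proj_repr.
by rewrite -rmorphM !ts_lift_proj rmorphM.
Qed.
HB.instance Definition _ :=
  GRing.isMonoidMorphism.Build (ts_quot I) B lift ts_lift_is_monoid_morphism.

End QuotientLift.

Section FreeMonomialEval.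
Context (T : choiceType) (B : nzRingType) (e : T -> B).

Definition fmonom_eval (u : {fmonom T}) : B := \prod_(x <- fmonom_val u) e x.

Fact fmonom_eval_mmorphism : mmorphism fmonom_eval.
Proof.
split=> [u v|]; first by rewrite /fmonom_eval fmM big_cat.
by rewrite /fmonom_eval fm1 big_nil.
Qed.
HB.instance Definition _ :=
  monalg.isMultiplicative.Build {fmonom T} B fmonom_eval fmonom_eval_mmorphism.

End FreeMonomialEval.

Section UglLift.
Context (K : fieldType) (N : nat) (B : nzRingType).
Context (f : {rmorphism K -> B}) (e : 'I_N -> 'I_N -> B).
Hypothesis f_central : forall a b, GRing.comm (f a) b.
Hypothesis e_rel : forall i j k l, gl_relator e i j k l = 0.

Definition gl_free_eval of (forall a b, GRing.comm (f a) b) : gl_free K N -> B :=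
  mmap f (fmonom_eval (fun ij => e ij.1 ij.2)).

Local Notation ev := (gl_free_eval f_central).

HB.instance Definition _ := GRing.Additive.copy ev
  (mmap f (fmonom_eval (fun ij : 'I_N * 'I_N => e ij.1 ij.2))).

Fact gl_free_eval_is_multiplicative : GRing.multiplicative ev.
Proof. exact/commr_mmap_is_multiplicative. Qed.
HB.instance Definition _ :=
  GRing.isMultiplicative.Build (gl_free K N) B ev gl_free_eval_is_multiplicative.

Lemma gl_free_eval_letter i j : ev (gl_letter K i j) = e i j.
Proof.
by rewrite /gl_free_eval mmapU /= rmorph1 mul1r /fmonom_eval fmU big_seq1.
Qed.

Lemma gl_free_eval_kill x :
  x \in tsi_pred (spanned_ideal (@gl_augmentation_relations K N)) -> ev x = 0.
Proof.
move=> /asboolP; elim=> {x} [x||x y _ IHx _ IHy|a x _ IHx|a x _ IHx].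
- move=> [i [j [k [l ->]]]]; rewrite gl_relator_morph -(e_rel i j k l).
  by rewrite /gl_relator /= !gl_free_eval_letter.
- exact: rmorph0.
- by rewrite rmorphB /= IHx IHy subrr.
- by rewrite rmorphM /= IHx mulr0.
- by rewrite rmorphM /= IHx mul0r.
Qed.

(** Coefficients are carried along by [f], since [B] has no algebra structure; the evaluation of
    words is multiplicative because the image of [f] is central. *)
Lemma Ugl_universal : exists phi : {rmorphism Ugl K N -> B},
  (forall i j, phi (Ugl_E K i j) = e i j) /\
  (forall a, phi (Ugl_scalar N a) = f a).
Proof.
exists (GRing.RMorphism.clone (Ugl K N) B (ts_lift gl_free_eval_kill) _).
split=> [i j|a]; first by rewrite -(gl_free_eval_letter i j); exact: ts_lift_proj.
by rewrite /Ugl_scalar [LHS]ts_lift_proj /= /gl_free_eval mmapC.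
Qed.

End UglLift.

(** * Cycles of first-return permutations *)

(** On [A] the map [g] factors through [f]. The factor [h] picks a preimage, and takes values in
    [option T2] because a point of [T1] may have none. *)
Lemma leq_card_imset_factor (T T1 T2 : finType) (f : T -> T1) (g : T -> T2)
    (A : {set T}) :
  (forall x y, f x = f y -> g x = g y) -> (#|g @: A| <= #|f @: A|)%N.
Proof.
move=> fg; pose h z := omap g [pick x in A | f x == z].
rewrite -(card_imset _ (@Some_inj _ : injective (@Some T2))).
apply: leq_trans (leq_imset_card h (f @: A)); apply/subset_leq_card/subsetP.
move=> _ /imsetP[_ /imsetP[x xA ->] ->]; apply/imsetP.
exists (f x); first exact: imset_f.
rewrite /h; case: pickP => [y /andP[_ /eqP /fg /= ->] //|/(_ x)].
by rewrite xA eqxx.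
Qed.

(** Invariant labellings are the pullbacks, under [ext], of arbitrary functions on the type [orb] of
    cycles. *)
Lemma card_porbit_invariant (T : finType) (s : {perm T}) n :
  #|[set f : {ffun T -> 'I_n} | [forall x, f (s x) == f x]]| = (n ^ ncycles s)%N.
Proof.
pose orb := {O : {set T} | O \in porbits s}.
pose cls x : orb := exist _ (porbit s x) (imset_f (porbit s) (isT : x \in T)).
pose ext (f : {ffun orb -> 'I_n}) : {ffun T -> 'I_n} := [ffun x => f (cls x)].
have clsP (O : orb) : exists x, O == cls x.
  by case: O => O OP; have /imsetP[x _ OE] := OP; exists x; apply/eqP/val_inj.
have ext_inj : injective ext.
  move=> f g fg; apply/ffunP=> O; have [x /eqP->] := clsP O.
  by have /ffunP/(_ x) := fg; rewrite !ffunE.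
have cls_s x : cls (s x) = cls x by apply/val_inj; have := porbit_perm s 1 x.
have -> : (n ^ ncycles s = #|{ffun orb -> 'I_n}|)%N.
  by rewrite card_ffun card_ord card_sig.
rewrite -(card_imset _ ext_inj); apply: eq_card => f; rewrite inE.
apply/forallP/imsetP => [fs|[g _ ->] x]; last by rewrite !ffunE cls_s.
exists [ffun O => f (xchoose (clsP O))] => //; apply/ffunP=> x; rewrite !ffunE.
move: (xchoose _) (xchooseP (clsP (cls x))) => y /eqP/(congr1 (@proj1_sig _ _))/=.
move=> /eqP; rewrite eq_porbit_mem => /porbitP[k ->].
elim: k => [|k IH]; first by rewrite expg0 perm1.
by rewrite expgSr permM (eqP (fs _)).
Qed.

Section SubpermCycles.
Context (m : nat) (s : 'S_m) (U : {set 'I_m}).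

Lemma subpermE u : enum_val (subperm s U u) = first_return s U (enum_val u).
Proof. by rewrite permE enum_rankK_in ?first_return_mem ?enum_valP. Qed.

Lemma first_return_uniq x n : x \in U -> iter n.+1 s x \in U ->
    (forall k, (k < n)%N -> iter k.+1 s x \notin U) ->
  first_return s U x = iter n.+1 s x.
Proof.
move=> xU nU min; have [p [-> pU pmin]] := first_returnP s xU.
case: (ltngtP n p) => [/pmin|/min|->//]; first by rewrite nU.
by rewrite pU.
Qed.

Lemma subperm_porbit u v : v \in porbit (subperm s U) u ->
  enum_val v \in porbit s (enum_val u).
Proof.
move=> /porbitP[k ->]; elim: k => [|k IH].
  by rewrite expg0 perm1 porbit_id.
rewrite expgSr permM subpermE.
have [n [-> _ _]] := first_returnP s (enum_valP ((subperm s U ^+ k)%g u)).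
rewrite -permX -eq_porbit_mem porbit_perm.
by rewrite eq_porbit_mem.
Qed.

(** A cycle of [s] that meets [U] does so in exactly one cycle of the first-return permutation; the
    remaining cycles avoid [U]. *)
Lemma ncycles_split : ncycles s =
  (ncycles (subperm s U) + #|[set O : {set _} in porbits s | [disjoint O & U]]|)%N.
Proof.
rewrite /ncycles -(cardsID [set O : {set _} | [disjoint O & U]] (porbits s)) addnC.
congr (_ + _)%N; last by apply: eq_card => O; rewrite !inE.
have -> : porbits s :\: [set O : {set _} | [disjoint O & U]] =
    (fun u : 'I_#|U| => porbit s (enum_val u)) @: [set: 'I_#|U|].
  apply/setP=> O; rewrite !inE; apply/andP/imsetP => [[OU /imsetP[x _ OE]]|[u _ ->]].
    have /pred0Pn[y /andP[yO yU]] := OU.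
    exists (enum_rank_in yU y); rewrite ?enum_rankK_in //.
    by apply/eqP; rewrite OE eq_sym eq_porbit_mem -OE.
  split; last exact: imset_f.
  by apply/pred0Pn; exists (enum_val u) => /=; rewrite porbit_id enum_valP.
have -> : porbits (subperm s U) = porbit (subperm s U) @: [set: 'I_#|U|].
  by apply/setP=> O; apply/imsetP/imsetP=> -[x _ ->]; exists x.
apply/eqP; rewrite eqn_leq; apply/andP; split; apply: leq_card_imset_factor => u v /eqP.
  rewrite eq_porbit_mem => /subperm_porbit uv.
  by apply/eqP; rewrite eq_porbit_mem.
rewrite eq_porbit_mem => /porbitP[n e]; apply/eqP; rewrite eq_porbit_mem.
by apply: (@subperm_orbit _ _ _ n); rewrite e permX.
Qed.

End SubpermCycles.

(** Along an orbit of [t] that avoids [U] the two permutations never differ, so all their iterates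
    at [x] coincide. *)
Lemma porbit_agree_off (T : finType) (s t : {perm T}) (U : {set T}) x :
    (forall y, t y \notin U -> t y = s y) ->
  [disjoint porbit t x & U] -> porbit t x = porbit s x.
Proof.
move=> ts tU; have ts_iter k : (t ^+ k)%g x = (s ^+ k)%g x.
  elim: k => [|k IH]; first by rewrite !expg0.
  rewrite !expgSr !permM -IH; apply: ts.
  rewrite -permM -expgSr.
  by rewrite (disjointFr tU) // mem_porbit.
by apply/setP=> y; apply/porbitP/porbitP=> -[k ->]; exists k; rewrite ts_iter.
Qed.

Section InducedPerm.
Context (m : nat) (U : {set 'I_m}) (u0 : 'I_m) (u0U : u0 \in U).
Context (s : 'S_#|U|).

(** For [s] the standard cycle this is the cyclic successor g_U of the overview. *)
Definition ext_fun (x : 'I_m) : 'I_m :=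
  if x \in U then enum_val (s (enum_rank_in u0U x)) else x.

Lemma ext_fun_mem x : (ext_fun x \in U) = (x \in U).
Proof. by rewrite /ext_fun; case: ifP => // xU; rewrite enum_valP. Qed.

Lemma ext_fun_inj : injective ext_fun.
Proof.
move=> x y xy; have := ext_fun_mem x; rewrite xy ext_fun_mem => yx.
move: xy; rewrite /ext_fun yx; case: ifP => // xU /enum_val_inj/perm_inj.
by move=> /(congr1 enum_val); rewrite !enum_rankK_in // yx.
Qed.

Definition ext_perm : 'S_m := perm ext_fun_inj.

Lemma ext_perm_mem x : (ext_perm x \in U) = (x \in U).
Proof. by rewrite permE ext_fun_mem. Qed.

Lemma ext_perm_off x : x \notin U -> ext_perm x = x.
Proof. by rewrite permE /ext_fun => /negbTE->. Qed.

Lemma ext_perm_val u : ext_perm (enum_val u) = enum_val (s u).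
Proof. by rewrite permE /ext_fun enum_valP enum_valK_in. Qed.

(** Let x in [U] first return under [a] at y. From y, the product (first [a^-1], then [ext_perm])
    walks back along the same [a]-path, whose inner points are off [U] and so fixed by [ext_perm].
    On reaching x it jumps to the image of x under [s], which is its first return to [U]. *)
Lemma subperm_mul_ext (a : 'S_m) :
  subperm (a^-1 * ext_perm)%g U = ((subperm a U)^-1 * s)%g.
Proof.
set h := (a^-1 * ext_perm)%g.
suff key v : subperm h U (subperm a U v) = s v.
  apply/permP=> w; rewrite -[w](permKV (subperm a U)) key.
  by rewrite permM permK.
apply: enum_val_inj; rewrite !subpermE.
have [n [-> nU nmin]] := first_returnP a (enum_valP v).
set x := enum_val v in nU nmin *; set y := iter n.+1 a x in nU *.
have hy k : (k <= n)%N -> iter k h y = iter (n.+1 - k) a x.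
  elim: k => [|k IH] kn; first by rewrite subn0.
  rewrite /= IH ?(ltnW kn) //.
  have -> : (n.+1 - k = (n - k.+1).+2)%N by lia.
  rewrite subSS permM /= permK.
  have -> : (n - k = (n - k.+1).+1)%N by lia.
  by rewrite ext_perm_off // nmin //; lia.
have hyn : iter n.+1 h y = enum_val (s v).
  by rewrite iterS hy // subSnn permM permK ext_perm_val.
rewrite (@first_return_uniq _ _ _ _ n) ?hyn ?enum_valP // => k kn.
rewrite hy //; have -> : (n.+1 - k.+1 = (n - k.+1).+1)%N by lia.
by rewrite nmin //; lia.
Qed.

(** Both permutations are split by [ncycles_split]. Off [U] the product acts as [a^-1], so it has
    the same cycles avoiding [U] as [a]. The additive form avoids truncated subtraction. *)
Lemma ncycles_mul_ext (a : 'S_m) :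
  (ncycles (a^-1 * ext_perm)%g + ncycles (subperm a U) =
   ncycles a + ncycles ((subperm a U)^-1 * s)%g)%N.
Proof.
rewrite (ncycles_split (a^-1 * ext_perm)%g U) (ncycles_split a U).
rewrite subperm_mul_ext.
suff -> : [set O : {set _} in porbits (a^-1 * ext_perm)%g | [disjoint O & U]] =
          [set O : {set _} in porbits a | [disjoint O & U]] by lia.
have agree x : a^-1%g x \notin U -> a^-1%g x = (a^-1 * ext_perm)%g x.
  by move=> xU; rewrite permM ext_perm_off.
rewrite -[in RHS]porbitsV; apply/setP=> O; rewrite !inE.
apply/andP/andP=> -[/imsetP[x _ ->] xU]; split=> //.
  rewrite (@porbit_agree_off _ a^-1%g _ U) ?imset_f // => y.
  by rewrite permM ext_perm_mem => yU; rewrite ext_perm_off.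
by rewrite (porbit_agree_off agree) // imset_f.
Qed.

End InducedPerm.

(** * Traces in the twisted standard representation *)

Lemma std_cycle_widen k (j : 'I_k) :
  std_cycle k.+1 (widen_ord (leqnSn k) j) = lift ord0 j.
Proof. by apply/val_inj; rewrite permE /= /bump modn_small // ltnS. Qed.

Lemma std_cycle_max k : std_cycle k.+1 ord_max = ord0.
Proof. by apply/val_inj; rewrite permE /= modnn. Qed.

Section Walks.
Context (A : nzRingType) (n : nat).
Implicit Types M : 'M[A]_n.+1.

Lemma sum_ffun_recr k (F : {ffun 'I_k.+1 -> 'I_n.+1} -> A) :
  \sum_i F i = \sum_(i : {ffun 'I_k -> 'I_n.+1}) \sum_c
    F [ffun x => if unlift ord_max x is Some y then i y else c].
Proof.
pose h (p : {ffun 'I_k -> 'I_n.+1} * 'I_n.+1) : {ffun 'I_k.+1 -> 'I_n.+1} :=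
  [ffun x => if unlift ord_max x is Some y then p.1 y else p.2].
rewrite (reindex h) /=; first by rewrite pair_bigA.
exists (fun i => ([ffun y => i (lift ord_max y)], i ord_max)) => [[i c] _|i _].
  by congr (_, _); rewrite /h ?ffunE /= ?unlift_none //; apply/ffunP=> y;
     rewrite !ffunE liftK.
apply/ffunP=> x; rewrite !ffunE /=; case: unliftP => [y ->|-> //].
by rewrite ffunE.
Qed.

(** The weight [G] on the end points is arbitrary so that the induction can absorb the last step of
    the walk into it. It stands on the right because [A] need not be commutative. *)
Lemma walk_sum M k (G : 'I_n.+1 -> 'I_n.+1 -> A) :
  \sum_(i : {ffun 'I_k.+1 -> 'I_n.+1})
    (\prod_(j < k) M (i (widen_ord (leqnSn k) j)) (i (lift ord0 j)))
      * G (i ord0) (i ord_max)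
  = \sum_a \sum_b (M ^+ k) a b * G a b.
Proof.
have liftW p (j : 'I_p) : widen_ord (leqnSn p) j = lift ord_max j.
  by apply/val_inj; rewrite /= /bump leqNgt ltn_ord.
elim: k G => [|k IH] G; rewrite sum_ffun_recr.
  rewrite (eq_bigr (fun=> \sum_c G c c)) => [|i _]; last first.
    apply: eq_bigr => c _; rewrite big_ord0 mul1r !ffunE.
    by rewrite (_ : ord0 = ord_max) ?unlift_none //; apply/val_inj.
  rewrite sumr_const card_ffun !card_ord expn0.
  apply: eq_bigr => a _; rewrite (bigD1 a) //= big1 ?addr0 => [|b ba].
    by rewrite expr0 mxE eqxx mul1r.
  by rewrite expr0 mxE eq_sym (negbTE ba) mul0r.
have step (i : {ffun 'I_k.+1 -> 'I_n.+1}) c :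
    let i' := [ffun x => if unlift ord_max x is Some y then i y else c] in
  (\prod_(j < k.+1) M (i' (widen_ord (leqnSn k.+1) j)) (i' (lift ord0 j)))
      * G (i' ord0) (i' ord_max) =
  (\prod_(j < k) M (i (widen_ord (leqnSn k) j)) (i (lift ord0 j)))
      * (M (i ord_max) c * G (i ord0) c).
  move=> i'; have i'l y : i' (lift ord_max y) = i y by rewrite ffunE liftK.
  have i'm : i' ord_max = c by rewrite ffunE unlift_none.
  rewrite big_ord_recr /= -mulrA i'm; congr (_ * (_ * _)).
  - apply: eq_bigr => j _; rewrite liftW i'l; congr (M _ _).
    by rewrite -i'l; congr (i' _); apply/val_inj; have := ltn_ord j; rewrite /= /bump; lia.
  - rewrite liftW i'l; congr (M _ _).
    by rewrite -i'm; congr (i' _); apply/val_inj.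
  - rewrite -(i'l ord0); congr (G (i' _) _).
    by apply/val_inj.
under eq_bigr => i _ do under eq_bigr => c _ do rewrite step.
under eq_bigr => i _ do rewrite -mulr_sumr.
rewrite (IH (fun a b => \sum_c M b c * G a c)).
apply: eq_bigr => a _; under eq_bigr => b _ do rewrite mulr_sumr.
rewrite exchange_big /=; apply: eq_bigr => c _.
rewrite exprSr -mulmxE mxE mulr_suml; by apply: eq_bigr => b _; rewrite mulrA.
Qed.

Lemma closed_walk_sum M k :
  \sum_(i : {ffun 'I_k.+1 -> 'I_n.+1})
     \prod_(j < k.+1) M (i j) (i (std_cycle k.+1 j)) = \tr (M ^+ k.+1).
Proof.
transitivity (\sum_a \sum_b (M ^+ k) a b * M b a).
  rewrite -walk_sum; apply: eq_bigr => i _; rewrite big_ord_recr /= std_cycle_max.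
  by congr (_ * _); apply: eq_bigr => j _; rewrite std_cycle_widen.
by rewrite exprSr; apply: eq_bigr => a _; rewrite -mulmxE mxE.
Qed.

End Walks.

Section TwistedUnits.
Context (R : comNzRingType) (n : nat) (t : R).

Definition twisted_unit (i j : 'I_n.+1) : 'M[R]_n.+1 :=
  delta_mx i j + (t *+ (i == j))%:M.

(** Scalar summands do not affect a commutator ([comm]), and the twists on the other side cancel:
    they add up to t times (delta_jk delta_il - delta_li delta_kj) = 0. *)
Lemma twisted_unit_relator i j k l : gl_relator twisted_unit i j k l = 0.
Proof.
have comm (a b : R) (X Y : 'M[R]_n.+1) :
    (X + a%:M) * (Y + b%:M) - (Y + b%:M) * (X + a%:M) = X * Y - Y * X.
  rewrite -!mulmxE !mulmxDl !mulmxDr (scalar_mxC a Y) (scalar_mxC b X).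
  rewrite -!scalar_mxM [b * a]mulrC -[X in X - _]addrA -[X in _ - X]addrA.
  by rewrite [X in _ - (_ + X)]addrCA opprD addrACA subrr addr0.
rewrite /gl_relator /twisted_unit comm -!mulmxE !mul_delta_mx_cond.
rewrite [k == j]eq_sym [i == l]eq_sym; case: (j == k); case: (l == i);
  rewrite !(mulr1n, mulr0n, raddf0, addr0, sub0r, subr0, opprK) ?subrr //.
  by rewrite [in X in _ - X]opprD [X in _ - X]addrACA subrr addr0 subrr.
by rewrite addNr.
Qed.

(** The entries are themselves matrices. One more factor gives x' = (N + t) x + t^k with N = [n.+1],
    solved by x = ((N + t)^k - t^k) / N; the division is avoided by characterizing N x. *)
Lemma twisted_power k : exists2 x : R,
  n.+1%:R * x = (n.+1%:R + t) ^+ k - t ^+ k &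
  forall i j, ((\matrix_(i, j) twisted_unit i j : 'M['M[R]_n.+1]_n.+1) ^+ k) i j
     = x *: delta_mx i j + (t ^+ k *+ (i == j))%:M.
Proof.
elim: k => [|k [x xE IH]].
  exists 0 => [|i j]; first by rewrite !expr0 subrr mulr0.
  by rewrite !expr0 mxE scale0r add0r; case: eqP; rewrite ?mulr1n ?mulr0n ?raddf0.
exists ((n.+1%:R + t) * x + t ^+ k) => [|i j].
  by rewrite mulrDr mulrCA xE !exprS; ring.
rewrite exprSr -mulmxE mxE.
under eq_bigr => c _.
  rewrite IH mxE -mulmxE mulmxDl !mulmxDr -!scalemxAl mul_delta_mx.
  rewrite mul_mx_scalar mul_scalar_mx -scalar_mxM.
  over.
rewrite !big_split /= -scaler_sumr sumr_const card_ord -scaler_sumr.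
rewrite (bigD1 j) //= big1 ?addr0 => [|c /negbTE->]; last by rewrite mulr0n scale0r.
rewrite (bigD1 i) //= big1 ?addr0 => [|c]; last first.
  by rewrite eq_sym => /negbTE->; rewrite mulr0n scale0r.
rewrite (bigD1 i) //= big1 ?addr0 => [|c]; last first.
  by rewrite eq_sym => /negbTE->; rewrite mulr0n mul0r raddf0.
rewrite !eqxx !mulr1n exprSr mulrnAr addrA; congr (_ + _).
by rewrite -[delta_mx i j *+ _]scaler_nat !scalerA -!scalerDl; congr (_ *: _); ring.
Qed.

(** The sum runs over closed walks, hence is the trace of a power of the matrix of [twisted_power].
    As the diagonal units sum to the identity, it is the scalar x + N t^(k+1). *)
Lemma twisted_casimir k : exists2 x : R,
  n.+1%:R * x =
    (n.+1%:R + t) ^+ k.+1 - (1 - n.+1%:R ^+ 2) * t ^+ k.+1 &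
  \sum_(i : {ffun 'I_k.+1 -> 'I_n.+1})
     \prod_(j < k.+1) twisted_unit (i j) (i (std_cycle k.+1 j)) = x%:M.
Proof.
have [x xE MkE] := twisted_power k.+1.
exists (x + n.+1%:R * t ^+ k.+1); first by rewrite mulrDr xE; ring.
pose M : 'M['M[R]_n.+1]_n.+1 := \matrix_(i, j) twisted_unit i j.
transitivity (\tr (M ^+ k.+1)).
  rewrite -closed_walk_sum; apply: eq_bigr => i _; apply: eq_bigr => j _.
  by rewrite mxE.
rewrite /mxtrace; under eq_bigr => i _ do rewrite MkE eqxx mulr1n.
rewrite big_split /= -scaler_sumr -mx1_sum_delta sumr_const card_ord.
by rewrite scalemx1 -rmorphMn -rmorphD /= mulr_natl.
Qed.

Lemma prod_delta_mx p (a b : 'I_p.+1 -> 'I_n.+1) :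
  \prod_(j < p.+1) (delta_mx (a j) (b j) : 'M[R]_n.+1) =
  (\prod_(j < p) (b (widen_ord (leqnSn p) j) == a (lift ord0 j))%:R)
    *: delta_mx (a ord0) (b ord_max).
Proof.
elim: p a b => [|p IH] a b.
  by rewrite big_ord1 big_ord0 scale1r (_ : ord_max = ord0) //; apply/val_inj.
rewrite big_ord_recr /= IH big_ord_recr /= -mulmxE -scalemxAl mul_delta_mx_cond.
rewrite -scaler_nat scalerA; congr (_ *: delta_mx _ _); last first.
  by congr (a _); apply/val_inj.
congr (_ * _); last by rewrite (_ : lift ord0 ord_max = ord_max) //; apply/val_inj.
apply: eq_bigr => j _; rewrite (_ : lift ord0 (widen_ord _ j) =
  widen_ord (leqnSn p.+1) (lift ord0 j)) //; exact/val_inj.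
Qed.

Lemma mxtrace_prod_delta p (a b : 'I_p.+1 -> 'I_n.+1) :
  \tr (\prod_(j < p.+1) (delta_mx (a j) (b j) : 'M[R]_n.+1)) =
  \prod_(j < p.+1) (b j == a (std_cycle p.+1 j))%:R.
Proof.
rewrite prod_delta_mx mxtraceZ big_ord_recr /= std_cycle_max; congr (_ * _).
  by apply: eq_bigr => j _; rewrite std_cycle_widen.
rewrite /mxtrace (bigD1 (a ord0)) //= big1 ?addr0 => [|i /negbTE ia].
  by rewrite mxE eqxx eq_sym.
by rewrite mxE ia.
Qed.

Lemma prod_addr_scalar m (x : 'I_m -> 'M[R]_n.+1) (c : 'I_m -> R) :
  \prod_k (x k + (c k)%:M) =
  \sum_(U : {set 'I_m}) (\prod_(k | k \notin U) c k) *: \prod_(k | k \in U) x k.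
Proof.
pose F k (b : bool) := if b then x k else (c k)%:M.
transitivity (\prod_k \sum_b F k b).
  by apply: eq_bigr => k _; rewrite big_bool.
rewrite bigA_distr_bigA /= (reindex (fun U : {set 'I_m} => [ffun k => k \in U])).
  apply: eq_bigr => U _.
  (* The matrix factors do not commute, so the scalars are pulled out one factor at a time along the
     enumeration. *)
  elim: (index_enum _) => [|k s IH]; first by rewrite !big_nil scale1r.
  rewrite !big_cons IH ffunE /F; case: (k \in U) => /=.
    by rewrite scalerAr.
  by rewrite -mulmxE mul_scalar_mx scalerA.
exists (fun f : {ffun 'I_m -> bool} => [set k | f k]) => [U _|f _].
  by apply/setP=> k; rewrite inE ffunE.
by apply/ffunP=> k; rewrite ffunE inE.
Qed.

(** The product of Kronecker symbols is the indicator of the labellings invariant under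
    [a^-1 * g]. *)
Lemma sum_ffun_eq m (a g : 'S_m) :
  \sum_(i : {ffun 'I_m -> 'I_n.+1}) \prod_k (i (a k) == i (g k))%:R =
  n.+1%:R ^+ ncycles (a^-1 * g)%g :> R.
Proof.
rewrite -natrX -card_porbit_invariant -sum1_card natr_sum [RHS]big_mkcond /=.
apply: eq_bigr => i _; rewrite inE -natr_prod.
case: (boolP [forall x, _]) => [/forallP ag|/forallPn[x]].
  rewrite big1 // => k _; have := ag (a k).
  by rewrite permM permK eq_sym => ->.
rewrite permM eq_sym => /negbTE nx; rewrite (bigD1 (a^-1%g x)) //= permKV nx.
by rewrite mul0n.
Qed.

Lemma mxtrace_twisted m (a : 'S_m) :
  \tr (\sum_(i : {ffun 'I_m -> 'I_n.+1}) \prod_k twisted_unit (i k) (i (a k))) =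
  n.+1%:R * \sum_(U : {set 'I_m})
    n.+1%:R ^+ (ncycles a - ncycles (subperm a U) + nfaces (subperm a U) - 1)
    * t ^+ (m - #|U|).
Proof.
rewrite raddf_sum /=; under eq_bigr => i _ do rewrite prod_addr_scalar raddf_sum.
rewrite exchange_big mulr_sumr /=; apply: eq_bigr => U _.
have card_notin : #|[pred k | k \notin U]| = (m - #|U|)%N.
  by rewrite -[X in (X - _)%N](card_ord m) -(cardC (mem U)) addKn; apply: eq_card.
have tE (i : {ffun 'I_m -> 'I_n.+1}) :
    \prod_(k | k \notin U) (t *+ (i k == i (a k))) =
    t ^+ (m - #|U|) * \prod_(k | k \notin U) (i k == i (a k))%:R.
  rewrite -card_notin -prodr_const -big_split /=; apply: eq_bigr => k _.
  by rewrite mulr_natr.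
under eq_bigr => i _ do rewrite mxtraceZ tE -mulrA.
rewrite -mulr_sumr mulrA [RHS]mulrC; congr (_ * _).
(* The empty set has no base point for [ext_perm]. There the matrix product is the identity, whose
   trace N is the prefactor, in accordance with the convention of one face. *)
have [U0|[u0 u0U]] := set_0Vmem U.
  have U_card : #|U| = 0%N by rewrite U0 cards0.
  have -> : ncycles (subperm a U) = 0%N.
    apply/eqP; rewrite cards_eq0; apply/eqP/setP=> O; rewrite inE.
    by apply/imsetP=> -[x]; have := ltn_ord x; rewrite [X in (_ < X)%N]U_card.
  have -> : nfaces (subperm a U) = 1%N by rewrite /nfaces [_ == _](introT eqP U_card).
  rewrite subn0 addnK mulrC.
  have -> : ncycles a = ncycles (a^-1 * 1)%g by rewrite mulg1 /ncycles porbitsV.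
  rewrite -sum_ffun_eq mulr_suml; apply: eq_bigr => i _.
  rewrite [X in \tr X]big_pred0 ?mxtrace1 => [|k]; last by rewrite U0 inE.
  congr (_ * _); apply: eq_big => k; rewrite ?U0 ?inE // => _.
  by rewrite perm1 eq_sym.
(* Factors off [U] require i(a k) = i(k). In [U] the chain of matrix units, closed up by the trace,
   requires i(a k) = i(next element of [U]), cyclically. Together: i(a k) = i(g_U k) for all k. *)
have prodE (i : {ffun 'I_m -> 'I_n.+1}) :
    (\prod_(k | k \notin U) (i k == i (a k))%:R) *
    \tr (\prod_(k in U) (delta_mx (i k) (i (a k)) : 'M[R]_n.+1)) =
    \prod_k (i (a k) == i (ext_perm u0U (std_cycle #|U|) k))%:R :> R.
  rewrite [RHS](bigID [in U]) /= mulrC; congr (_ * _); last first.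
    by apply: eq_bigr => k kU; rewrite ext_perm_off // eq_sym.
  rewrite [RHS]big_enum_val /=.
  have -> : \prod_(k in U) (delta_mx (i k) (i (a k)) : 'M[R]_n.+1) =
     \prod_(j < #|U|) delta_mx (i (enum_val j)) (i (a (enum_val j))).
    rewrite -big_filter.
    have -> : [seq k <- index_enum 'I_m | k \in U] = enum U.
      by rewrite [index_enum _]unlock.
    rewrite (big_nth u0) -cardE big_mkord; apply: eq_bigr => j _.
    by rewrite (enum_val_nth u0).
  under [RHS]eq_bigr => j _ do rewrite ext_perm_val.
  (* [mxtrace_prod_delta] needs a length of the form [p.+1]; [enum_val], whose type mentions [#|U|],
     is generalized first. *)
  have [p pE] : exists p, #|U| = p.+1.
    by exists #|U|.-1; rewrite prednK //; apply/card_gt0P; exists u0.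
  move: (@enum_val _ (mem U)); rewrite pE => ev; exact: mxtrace_prod_delta.
under eq_bigr => i _ do rewrite prodE.
rewrite sum_ffun_eq -exprS; congr (_ ^+ _).
(* The prefactor N has used up the -1 of the exponent; the two inequalities below make the truncated
   subtractions exact. *)
have U_gt0 : (0 < #|U|)%N by apply/card_gt0P; exists u0.
have := ncycles_mul_ext u0U (std_cycle #|U|) a.
have := nfaces_gt0 (subperm a U); have := ncycles_subperm a U.
rewrite /nfaces eqn0Ngt U_gt0 /=.
lia.
Qed.

End TwistedUnits.

(** * Evaluation at positive integers and conclusion *)

Lemma poly_eq_at_pos_nat (A : idomainType) (p q : {poly A}) :
    injective (fun n : nat => n%:R : A) ->
  (forall n : nat, p.[n.+1%:R] = q.[n.+1%:R]) -> p = q.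
Proof.
move=> inj_nat pq; apply/eqP; rewrite -subr_eq0; apply/eqP.
pose rs := [seq n.+1%:R : A | n <- iota 0 (size (p - q))].
(* The [size] of a nonzero polynomial is its degree plus one, so this many distinct roots force the
   difference to vanish. *)
apply: (@roots_geq_poly_eq0 _ _ rs).
- by apply/allP=> _ /mapP[n _ ->]; rewrite /root !hornerE pq subrr.
- by rewrite map_inj_uniq ?iota_uniq // => i j /inj_nat [].
- by rewrite size_map size_iota.
Qed.

Lemma poly_natr_inj (K : numFieldType) : injective (fun n : nat => n%:R : {poly K}).
Proof. by move=> i j; rewrite -!polyC_natr => /polyC_inj/eqP; rewrite eqr_nat => /eqP. Qed.

Lemma horner_eps_casimir (K : numFieldType) n k x :
    n.+1%:R * x = (n.+1%:R + 'X) ^+ k - (1 - n.+1%:R ^+ 2) * 'X ^+ k ->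
  (eps_casimir K k).[n.+1%:R] = x.
Proof.
move=> xE; apply: (@mulfI _ (n.+1%:R : {poly K})).
  by rewrite -[0]/(0%:R) (inj_eq (@poly_natr_inj K)).
rewrite xE; have := congr1 (fun p => p.[n.+1%:R]) (eps_casimirE K k).
by rewrite /eps_numer /varN /varEps !hornerE.
Qed.

Lemma Ugl_twisted_rep (K : numFieldType) n :
  exists phi : {rmorphism Ugl K n.+1 -> 'M[{poly K}]_n.+1},
    (forall i j, phi (Ugl_E K i j) = twisted_unit 'X i j) /\
    (forall a, phi (Ugl_scalar n.+1 a) = a%:P%:M).
Proof.
pose f : {rmorphism K -> 'M[{poly K}]_n.+1} :=
  GRing.RMorphism.clone _ _ (@scalar_mx _ n.+1 \o polyC) _.
have f_central a b : GRing.comm (f a) b.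
  by rewrite /GRing.comm -!mulmxE [RHS]scalar_mxC.
exact: (Ugl_universal f_central (@twisted_unit_relator _ n 'X)).
Qed.

(** Apply the twisted representation to the identity that defines [w]: Casimir elements and
    coefficients become scalar matrices, and the substitution into [w] becomes the value of
    [F_eps w] at N. *)
Lemma F_eps_at (K : numFieldType) m (alpha : 'S_m) (w : glpoly K) n :
  is_w_gl alpha w ->
  \sum_(i : {ffun 'I_m -> 'I_n.+1}) \prod_k twisted_unit 'X (i k) (i (alpha k))
  = ((F_eps w).[n.+1%:R])%:M :> 'M[{poly K}]_n.+1.
Proof.
move=> /(_ n.+1 isT) hw; have [phi [phiE phiS]] := Ugl_twisted_rep K n.
have phi_w p (b : 'S_p) : phi (w_glN K n.+1 b) =
    \sum_(i : {ffun 'I_p -> 'I_n.+1}) \prod_k twisted_unit 'X (i k) (i (b k)).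
  rewrite rmorph_sum; apply: eq_bigr => i _; rewrite rmorph_prod.
  by apply: eq_bigr => k _; rewrite phiE.
have phi_casimir k : phi (casimir K n.+1 k.+1) = ((eps_casimir K k.+1).[n.+1%:R])%:M.
  have [x xE sumE] := twisted_casimir n ('X : {poly K}) k.
  by rewrite /casimir phi_w sumE (horner_eps_casimir xE).
rewrite -phi_w -hw /F_eps /glpoly_subst /mmap rmorph_sum horner_sum rmorph_sum /=.
apply: eq_bigr => mon _; rewrite rmorphM /= phiS hornerM scalar_mxM -mulmxE.
congr (_ *m _).
  by rewrite -polyC_natr horner_map.
rewrite rmorph_prod horner_prod rmorph_prod /=; apply: eq_bigr => k _.
by rewrite rmorphXn /= phi_casimir horner_exp rmorphXn.
Qed.

Theorem mainTheorem3 (R : realType) (m : nat) (alpha : 'S_m)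
    (w_alpha : glpoly R[i]) (hw : is_w_gl alpha w_alpha) :
  F_eps w_alpha =
  \sum_(U : {set 'I_m})
    varN R[i] ^+ (ncycles alpha - ncycles (subperm alpha U)
                  + nfaces (subperm alpha U) - 1)
    * varEps R[i] ^+ (m - #|U|).
Proof.
apply: (poly_eq_at_pos_nat (@poly_natr_inj _)) => n.
(* N times the value at N is the trace of the scalar matrix in [F_eps_at]. *)
apply: (@mulfI _ (n.+1%:R : {poly R[i]})).
  by rewrite -[0]/(0%:R) (inj_eq (@poly_natr_inj _)).
have /(congr1 mxtrace) := F_eps_at n hw.
rewrite mxtrace_twisted mxtrace_scalar => trE; rewrite [LHS]mulr_natl -trE; congr (_ * _).
rewrite horner_sum; apply: eq_bigr => U _.
by rewrite /varN /varEps !hornerE.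
Qed.
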